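(* Let $|q|<1$, let $a$ be a complex number, and let $g:\mathbb{Z}\to\mathbb{C}$ be any function such that both series below converge. Then \[ \sum_{m,n\geq 0}\frac{(a;q)_m(a;q)_n(q/a;q)_{m-n}}{(q;q)_m(q;q)_n(a;q)_{m-n}}\left(\frac{q}{a^2}\right)^{n}g(m-n) =\frac{(q/a,q/a;q)_{\infty}}{(q,q/a^2;q)_{\infty}}\sum_{k=-\infty}^{\infty}g(k). \]
   Context: Notation: $(x;q)_n=(1-x)(1-xq)\cdots(1-xq^{n-1})$ for integers $n\ge0$, extended to negative integers by $(x;q)_{-n}=1/(xq^{-n};q)_n$; $(x;q)_\infty=\prod_{i\ge0}(1-xq^i)$; $(x_1,\dots,x_r;q)_n=\prod_i(x_i;q)_n$. Parameters are assumed such that no denominator vanishes. *)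

(* Defs.v *)
From Stdlib Require Export Reals ZArith.
From Coquelicot Require Export Coquelicot.

Open Scope C_scope.

Fixpoint qpoch (x q : C) (n : nat) : C :=
  match n with
  | O => 1
  | S m => qpoch x q m * (1 - x * q ^ m)
  end.

(* For k = -n < 0 this is 1 / (x q^{-n}; q)_n.  Division by zero is total in C
   (with a junk value), so the value is meaningful only when q <> 0 and
   qpoch (x / q ^ n) q n <> 0. *)
Definition qpochZ (x q : C) (k : Z) : C :=
  match k with
  | Z0 => 1
  | Zpos p => qpoch x q (Pos.to_nat p)
  | Zneg p => 1 / qpoch (x / q ^ Pos.to_nat p) q (Pos.to_nat p)
  end.

(* The limit of the finite products; it exists whenever Cmod q < 1. *)
Definition qpoch_inf (x q : C) : C :=
  iota (T := C_CompleteNormedModule)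
    (fun l : C => filterlim (qpoch x q) eventually (locally l)).

(* Convergence of a double series in the sense of Pringsheim: the rectangular
   partial sums tend to l as both bounds go to infinity independently.  An
   absolutely convergent double series converges in this sense, to its
   unordered sum. *)
Definition is_double_series (f : nat -> nat -> C) (l : C) : Prop :=
  filterlim
    (fun p : nat * nat => sum_n (fun m => sum_n (fun n => f m n) (snd p)) (fst p))
    (filter_prod eventually eventually) (locally l).

(* The terms of index k >= 0 and those of index k < 0 form two separately
   convergent series. *)
Definition is_bilateral_series (g : Z -> C) (l : C) : Prop :=
  exists lp ln : C,
    is_series (fun k : nat => g (Z.of_nat k)) lp /\
    is_series (fun k : nat => g (- Z.of_nat (S k))%Z) ln /\
    l = lp + ln.

(* Main.v *)
(* Put z = q/a^2. Reflecting negative indices shows that the coefficient of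
   g(m-n) is symmetric in m and n; with k = |m-n| and n the smaller index it is
     t_k(n) = (q/a)_k/(a)_k * (a)_{n+k}/(q)_{n+k} * (a)_n/(q)_n * z^n.
   If |z| < 1, the q-Gauss sum says that sum_n t_k(n) is the same constant K for
   every k: sum_n (t_{k+1}(n) - t_k(n)) telescopes to 0, and k -> oo reduces the
   evaluation to the q-binomial theorem. Along square partial sums the
   double series is then K times the symmetric partial sums of g, up to an error
   controlled by g(k) -> 0 and the geometric decay of t_k(n) in n, so no absolute
   convergence of g is required. If |z| >= 1, the t_k(n) stay away from 0 along
   each diagonal, so convergence of the double series forces g = 0. *)
Require Import Defs.
From Stdlib Require Import Lia Lra.

(** * Limits of complex sequences *)

Notation Clim u l := (filterlim u eventually (locally (T := C_UniformSpace) (l%C : C))).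

Lemma filterlim_Cmod {T : Type} {F : (T -> Prop) -> Prop} {FF : Filter F}
  (u : T -> C) (l : C) :
  filterlim u F (locally (T := C_UniformSpace) l) <->
  forall eps : R, (0 < eps)%R -> F (fun x => (Cmod (u x - l) < eps)%R).
Proof.
rewrite (filterlim_locally_ball_norm (K := C_AbsRing) (U := C_NormedModule)).
split; intros H.
- intros eps He; exact (H (mkposreal eps He)).
- intros eps; exact (H eps (cond_pos eps)).
Qed.

Lemma Clim_Cmod (u : nat -> C) (l : C) :
  Clim u l <-> is_lim_seq (fun n => Cmod (u n - l)) 0.
Proof.
rewrite filterlim_Cmod.
rewrite <- is_lim_seq_spec.
split; intros H eps.
- generalize (H eps (cond_pos eps)); apply filter_imp; intros n Hn.
  rewrite Rminus_0_r, Rabs_pos_eq; [exact Hn | apply Cmod_ge_0].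
- intros He; generalize (H (mkposreal eps He)); apply filter_imp; intros n; simpl.
  rewrite Rminus_0_r, Rabs_pos_eq; [easy | apply Cmod_ge_0].
Qed.

Lemma Clim_squeeze (u : nat -> C) (l : C) (e : nat -> R) :
  (forall n, (Cmod (u n - l) <= e n)%R) -> is_lim_seq e 0 -> Clim u l.
Proof.
intros H He; apply Clim_Cmod.
apply is_lim_seq_le_le with (fun _ => 0%R) e; auto.
- intros n; split; [apply Cmod_ge_0 | apply H].
- apply is_lim_seq_const.
Qed.

Lemma Clim_unique (u : nat -> C) (l l' : C) : Clim u l -> Clim u l' -> l = l'.
Proof.
intros H H'.
exact (filterlim_locally_unique (V := C_NormedModule) u l l' H H').
Qed.

Lemma Clim_ext (u v : nat -> C) (l : C) :
  (forall n, u n = v n) -> Clim u l -> Clim v l.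
Proof. intros H; apply filterlim_ext; exact H. Qed.

Lemma Clim_const (l : C) : Clim (fun _ => l) l.
Proof. apply filterlim_const. Qed.

Lemma Clim_comp (u : nat -> C) (l : C) (f : nat -> nat) :
  filterlim f eventually eventually -> Clim u l -> Clim (fun n => u (f n)) l.
Proof. intros Hf Hu; exact (filterlim_comp _ _ _ _ _ _ _ _ Hf Hu). Qed.

Lemma Clim_shift (u : nat -> C) (l : C) (k : nat) :
  Clim u l -> Clim (fun n => u (n + k)%nat) l.
Proof.
apply Clim_comp; intros P [N HN]; exists N; intros n Hn; apply HN; lia.
Qed.

Lemma Clim_shift_inv (u : nat -> C) (l : C) :
  Clim (fun n => u (S n)) l -> Clim u l.
Proof.
intros H P HP; destruct (H P HP) as [N HN]; exists (S N).
intros [|n] Hn; [lia | apply HN; lia].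
Qed.

Lemma Clim_plus (u v : nat -> C) (l m : C) :
  Clim u l -> Clim v m -> Clim (fun n => u n + v n) (l + m).
Proof.
rewrite !Clim_Cmod; intros Hu Hv.
apply Clim_Cmod, Clim_squeeze with (fun n => (Cmod (u n - l) + Cmod (v n - m))%R).
- intros n; replace (u n + v n - (l + m)) with ((u n - l) + (v n - m)) by ring.
  apply Cmod_triangle.
- replace (Finite 0) with (Finite (0 + 0)%R) by (f_equal; ring).
  apply is_lim_seq_plus'; assumption.
Qed.

Lemma Clim_mult (u v : nat -> C) (l m : C) :
  Clim u l -> Clim v m -> Clim (fun n => u n * v n) (l * m).
Proof.
rewrite !Clim_Cmod; intros Hu Hv.
apply Clim_Cmod, Clim_squeeze with
  (fun n => (Cmod (u n - l) * Cmod (v n - m)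
             + (Cmod l * Cmod (v n - m) + Cmod m * Cmod (u n - l)))%R).
- intros n.
  replace (u n * v n - l * m) with
    ((u n - l) * (v n - m) + (l * (v n - m) + m * (u n - l))) by ring.
  eapply Rle_trans; [apply Cmod_triangle |]; rewrite Cmod_mult.
  apply Rplus_le_compat_l; eapply Rle_trans; [apply Cmod_triangle |].
  rewrite !Cmod_mult; apply Rle_refl.
- replace (Finite 0) with (Finite (0 * 0 + (Cmod l * 0 + Cmod m * 0))%R)
    by (f_equal; ring).
  apply is_lim_seq_plus'; [apply is_lim_seq_mult'; assumption |].
  apply is_lim_seq_plus'; apply is_lim_seq_mult'; auto; apply is_lim_seq_const.
Qed.

Lemma Clim_scal (u : nat -> C) (l c : C) :
  Clim u l -> Clim (fun n => c * u n) (c * l).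
Proof. apply Clim_mult, Clim_const. Qed.

Lemma Clim_minus (u v : nat -> C) (l m : C) :
  Clim u l -> Clim v m -> Clim (fun n => u n - v n) (l - m).
Proof.
intros Hu Hv; replace (l - m) with (l + (-1) * m) by ring.
apply Clim_ext with (fun n => u n + (-1) * v n); [intros n; ring |].
apply Clim_plus; [exact Hu | apply Clim_scal, Hv].
Qed.

Lemma Clim_norm (u : nat -> C) (l : C) :
  Clim u l -> is_lim_seq (fun n => Cmod (u n)) (Cmod l).
Proof.
intros H; apply filterlim_comp with (2 := filterlim_norm (V := C_NormedModule) l).
exact H.
Qed.

(** The lower bound [c] passes to the limit, so [l] is nonzero and
    [|1/u n - 1/l| <= |u n - l| / c^2]. *)
Lemma Clim_inv (u : nat -> C) (l : C) (c : R) :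
  (0 < c)%R -> (forall n, (c <= Cmod (u n))%R) -> Clim u l ->
  Clim (fun n => / u n) (/ l).
Proof.
intros Hc Hu Hl.
assert (Hlc : (c <= Cmod l)%R).
{ apply (is_lim_seq_le (fun _ => c) (fun n => Cmod (u n)) c (Cmod l)).
  - exact Hu.
  - apply is_lim_seq_const.
  - apply Clim_norm, Hl. }
assert (Hl0 : l <> 0) by (apply Cmod_gt_0; lra).
apply Clim_squeeze with (fun n => (/ (c * c) * Cmod (u n - l))%R).
- intros n; assert (Hun : u n <> 0) by (apply Cmod_gt_0; specialize (Hu n); lra).
  replace (/ u n - / l) with (/ (u n * l) * - (u n - l)) by (field; auto).
  rewrite Cmod_mult, Cmod_opp, Cmod_inv, Cmod_mult by (apply Cmult_neq_0; auto).
  apply Rmult_le_compat_r; [apply Cmod_ge_0 |].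
  apply Rinv_le_contravar; [nra |].
  apply Rmult_le_compat; auto; lra.
- replace (Finite 0) with (Finite (/ (c * c) * 0)%R) by (f_equal; ring).
  apply is_lim_seq_mult'; [apply is_lim_seq_const | apply Clim_Cmod, Hl].
Qed.

Lemma Clim_bounded (u : nat -> C) (l : C) :
  Clim u l -> exists B : R, (0 < B)%R /\ forall n, (Cmod (u n) <= B)%R.
Proof.
intros H; destruct (filterlim_bounded (V := C_NormedModule) u) as [B HB].
- exists l; exact H.
- exists (Rmax B 1); split.
  + apply Rlt_le_trans with 1%R; [lra | apply Rmax_r].
  + intros n; apply Rle_trans with B; [apply HB | apply Rmax_l].
Qed.

(** By uniqueness of limits [iota] picks the limit. This gives meaning to [qpoch_inf], and later
    turns existence for each index into one sequence of limits. *)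
Lemma Clim_iota (u : nat -> C) (l : C) : Clim u l ->
  Clim u (iota (T := C_CompleteNormedModule) (fun l : C => Clim u l)).
Proof.
intros H; assert (E : iota (T := C_CompleteNormedModule) (fun l : C => Clim u l) = l)
  by exact (iota_filterlim_locally (V := C_CompleteNormedModule) u l H).
now rewrite E.
Qed.

(** * Finite sums of complex numbers *)

(** Fixes the additive monoid of [C] once and for all. The upper bound is inclusive: there are
    [n + 1] terms. *)
Definition Csum (u : nat -> C) : nat -> C := sum_n (G := C_AbelianMonoid) u.

Lemma Csum_S (u : nat -> C) (n : nat) : Csum u (S n) = Csum u n + u (S n).
Proof. exact (sum_Sn (G := C_AbelianMonoid) u n). Qed.

Lemma Csum_0 (u : nat -> C) : Csum u 0%nat = u 0%nat.
Proof. exact (sum_O (G := C_AbelianMonoid) u). Qed.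

Lemma Csum_plus (u v : nat -> C) (n : nat) :
  Csum (fun i => u i + v i) n = Csum u n + Csum v n.
Proof. exact (sum_n_plus (G := C_AbelianMonoid) u v n). Qed.

Lemma Csum_scal (c : C) (u : nat -> C) (n : nat) :
  Csum (fun i => c * u i) n = c * Csum u n.
Proof. exact (sum_n_mult_l (K := C_Ring) c u n). Qed.

Lemma Csum_ext (u v : nat -> C) (n : nat) :
  (forall i, (i <= n)%nat -> u i = v i) -> Csum u n = Csum v n.
Proof. exact (sum_n_ext_loc (G := C_AbelianMonoid) u v n). Qed.

Lemma Csum_minus (u v : nat -> C) (n : nat) :
  Csum (fun i => u i - v i) n = Csum u n - Csum v n.
Proof.
rewrite (Csum_ext _ (fun i => u i + (-1) * v i)) by (intros i _; ring).
rewrite Csum_plus, Csum_scal; ring.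
Qed.

Lemma Csum_split (u : nat -> C) (L n : nat) :
  Csum u (S L + n) = Csum u L + Csum (fun i => u (S L + i)%nat) n.
Proof.
induction n as [|n IH].
- now rewrite Nat.add_0_r, Csum_S, Csum_0, Nat.add_0_r.
- rewrite Nat.add_succ_r, !Csum_S, IH, Nat.add_succ_r; ring.
Qed.

Lemma Csum_rev (u : nat -> C) (n : nat) :
  Csum (fun i => u (n - i)%nat) n = Csum u n.
Proof.
revert u; induction n as [|n IH]; intros u; [now rewrite !Csum_0 |].
rewrite Csum_S, Nat.sub_diag.
rewrite (Csum_ext _ (fun i => u (S (n - i)))).
2: { intros i Hi; f_equal; lia. }
rewrite (IH (fun i => u (S i))); clear IH.
induction n as [|n IH]; [now rewrite Csum_S, !Csum_0; ring |].
now rewrite Csum_S, (Csum_S u), <- IH; ring_simplify.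
Qed.

Lemma Csum_telescope (u G : nat -> C) (n : nat) :
  (forall i, u i = G (S i) - G i) -> Csum u n = G (S n) - G 0%nat.
Proof.
intros H; induction n as [|n IH]; [now rewrite Csum_0 |].
rewrite Csum_S, IH, H; ring.
Qed.

(** * Geometric majorants and Tannery's theorem *)

Lemma Cmod_Csum_le (u : nat -> C) (v : nat -> R) (n : nat) :
  (forall i, (Cmod (u i) <= v i)%R) -> (Cmod (Csum u n) <= sum_n v n)%R.
Proof.
intros H; induction n as [|n IH]; [rewrite Csum_0, sum_O; apply H |].
rewrite Csum_S, sum_Sn; eapply Rle_trans; [apply Cmod_triangle |].
apply Rplus_le_compat; [exact IH | apply H].
Qed.

Lemma sum_geom_le (B r : R) (n : nat) :
  (0 <= B)%R -> (0 <= r < 1)%R ->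
  (sum_n (fun i => B * r ^ i) n <= B / (1 - r))%R.
Proof.
intros HB Hr.
assert (H : sum_n (fun i => (B * r ^ i)%R) n = (B / (1 - r) * (1 - r ^ S n))%R).
{ induction n as [|n IH]; [rewrite sum_O; simpl; field; lra |].
  rewrite sum_Sn, IH; unfold plus; simpl; field; lra. }
rewrite H; rewrite <- (Rmult_1_r (B / (1 - r))) at 2.
apply Rmult_le_compat_l.
- apply Rdiv_le_0_compat; lra.
- assert (0 <= r ^ S n)%R by (apply pow_le; lra); lra.
Qed.

Lemma Cmod_Csum_geom_le (u : nat -> C) (B r : R) (n : nat) :
  (0 <= r < 1)%R -> (forall i, (Cmod (u i) <= B * r ^ i)%R) ->
  (Cmod (Csum u n) <= B / (1 - r))%R.
Proof.
intros Hr Hu; eapply Rle_trans; [apply Cmod_Csum_le, Hu |].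
apply sum_geom_le; auto.
generalize (Hu 0%nat), (Cmod_ge_0 (u 0%nat)); simpl; lra.
Qed.

Lemma Clim_Csum_geom (u : nat -> C) (B r : R) :
  (0 <= r < 1)%R -> (forall i, (Cmod (u i) <= B * r ^ i)%R) ->
  exists l : C, Clim (Csum u) l.
Proof.
intros Hr Hu.
apply (ex_series_le (V := C_CompleteNormedModule) u (fun i => (B * r ^ i)%R)).
- exact Hu.
- apply (ex_series_scal (V := R_NormedModule) B).
  exists (/ (1 - r))%R; apply is_series_geom; rewrite Rabs_pos_eq; lra.
Qed.

Lemma lim_geom (B r : R) : (0 <= r < 1)%R -> is_lim_seq (fun n => B * r ^ n)%R 0.
Proof.
intros Hr; replace (Finite 0) with (Finite (B * 0)%R) by (f_equal; ring).
apply is_lim_seq_mult'; [apply is_lim_seq_const |].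
apply is_lim_seq_geom; rewrite Rabs_pos_eq; lra.
Qed.

Lemma Csum_head (u : nat -> C) (n : nat) :
  Csum u (S n) = u 0%nat + Csum (fun i => u (S i)) n.
Proof. rewrite <- (Csum_0 u); exact (Csum_split u 0 n). Qed.

(** The tail is the limit of finite blocks starting at [S j], each dominated by a geometric sum of
    ratio [r]; one factor [r] is given away. *)
Lemma Csum_tail_le (u : nat -> C) (l : C) (B r : R) (j : nat) :
  (0 <= r < 1)%R -> (forall i, (Cmod (u i) <= B * r ^ i)%R) -> Clim (Csum u) l ->
  (Cmod (l - Csum u j) <= B / (1 - r) * r ^ j)%R.
Proof.
intros Hr Hu Hl.
assert (HB : (0 <= B)%R)
  by (generalize (Hu 0%nat), (Cmod_ge_0 (u 0%nat)); simpl; lra).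
apply (is_lim_seq_le (fun n => Cmod (Csum u (n + S j) - Csum u j))
         (fun _ => (B / (1 - r) * r ^ j)%R)
         (Cmod (l - Csum u j)) (B / (1 - r) * r ^ j)%R).
- intros n; rewrite Nat.add_comm, Csum_split.
  replace (Csum u j + Csum (fun i => u (S j + i)%nat) n - Csum u j)
    with (Csum (fun i => u (S j + i)%nat) n) by ring.
  replace (B / (1 - r) * r ^ j)%R with ((B * r ^ j) / (1 - r))%R by (field; lra).
  apply Cmod_Csum_geom_le; auto; intros i.
  eapply Rle_trans; [apply Hu |]; rewrite pow_add; simpl.
  assert (0 <= r ^ j)%R by (apply pow_le; lra).
  assert (0 <= r ^ i)%R by (apply pow_le; lra).
  assert (0 <= r ^ j * r ^ i)%R by nra.
  assert (0 <= B * (r ^ j * r ^ i))%R by nra.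
  nra.
- apply Clim_norm, Clim_minus; [apply Clim_shift, Hl | apply Clim_const].
- apply is_lim_seq_const.
Qed.

(* Tannery's theorem for null sequences, uniform in the number of terms. *)
Lemma tannery_uniform (v : nat -> nat -> C) (B r : R) :
  (0 <= r < 1)%R ->
  (forall j i, (Cmod (v j i) <= B * r ^ i)%R) ->
  (forall i, Clim (fun j => v j i) 0) ->
  forall eps : R, (0 < eps)%R ->
  eventually (fun j => forall n, (Cmod (Csum (v j) n) < eps)%R).
Proof.
intros Hr Hv H0 eps Heps.
assert (HB : (0 <= B)%R)
  by (generalize (Hv 0%nat 0%nat), (Cmod_ge_0 (v 0%nat 0%nat)); simpl; lra).
(* Finitely many null sequences: up to a fixed [L] the partial sums are small for large [j],
   uniformly in [n]. *)
assert (Hhead : forall L, forall eps : R, (0 < eps)%R ->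
  eventually (fun j => forall n, (n <= L)%nat -> (Cmod (Csum (v j) n) < eps)%R)).
{ clear eps Heps; induction L as [|L IH]; intros eps Heps.
  - generalize (proj1 (filterlim_Cmod _ _) (H0 0%nat) eps Heps).
    apply filter_imp; intros j Hj n Hn; replace n with 0%nat by lia.
    rewrite Csum_0; revert Hj; now replace (v j 0%nat - 0) with (v j 0%nat) by ring.
  - assert (He2 : (0 < eps / 2)%R) by lra.
    generalize (filter_and _ _ (IH _ He2)
      (proj1 (filterlim_Cmod _ _) (H0 (S L)) _ He2)).
    apply filter_imp; intros j [H1 H2] n Hn.
    destruct (Nat.eq_dec n (S L)) as [-> | Hne].
    + rewrite Csum_S; eapply Rle_lt_trans; [apply Cmod_triangle |].
      specialize (H1 L (Nat.le_refl _)).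
      replace (v j (S L) - 0) with (v j (S L)) in H2 by ring; lra.
    + specialize (H1 n ltac:(lia)); lra. }
assert (He2 : (0 < eps / 2)%R) by lra.
(* [L] is chosen so that the terms beyond it contribute less than [eps / 2], whatever [j] is. *)
destruct (proj2 (is_lim_seq_spec _ _) (lim_geom (B / (1 - r)) r Hr) (mkposreal _ He2))
  as [L HL].
specialize (HL (S L) ltac:(lia)); simpl pos in HL.
rewrite Rminus_0_r in HL; apply Rabs_def2 in HL as [HL _].
generalize (Hhead L _ He2); apply filter_imp; intros j Hj n.
destruct (Nat.le_gt_cases n L) as [Hn | Hn].
- specialize (Hj n Hn); lra.
- replace n with (S L + (n - S L))%nat by lia; rewrite Csum_split.
  eapply Rle_lt_trans; [apply Cmod_triangle |].
  specialize (Hj L (Nat.le_refl _)).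
  assert (Ht : (Cmod (Csum (fun i => v j (S L + i)%nat) (n - S L))
                <= (B * r ^ S L) / (1 - r))%R).
  { apply Cmod_Csum_geom_le; auto.
    intros i; rewrite Rmult_assoc, <- pow_add; apply Hv. }
  replace (B * r ^ S L / (1 - r))%R with (B / (1 - r) * r ^ S L)%R in Ht by (field; lra).
  lra.
Qed.

(** The majorant passes to [u], so the differences [v j i - u i] are null sequences with majorant
    [2 B r^i]. The uniform version bounds their partial sums at a fixed large [j], and the number of
    terms may then go to infinity. *)
Lemma tannery (v : nat -> nat -> C) (u : nat -> C) (s : nat -> C) (t : C) (B r : R) :
  (0 <= r < 1)%R ->
  (forall j i, (Cmod (v j i) <= B * r ^ i)%R) ->
  (forall i, Clim (fun j => v j i) (u i)) ->
  (forall j, Clim (Csum (v j)) (s j)) -> Clim (Csum u) t ->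
  Clim s t.
Proof.
intros Hr Hv Hu Hs Ht.
assert (HuB : forall i, (Cmod (u i) <= B * r ^ i)%R).
{ intros i; apply (is_lim_seq_le (fun j => Cmod (v j i)) (fun _ => (B * r ^ i)%R)
                     (Cmod (u i)) (B * r ^ i)%R).
  - intros j; apply Hv.
  - apply Clim_norm, Hu.
  - apply is_lim_seq_const. }
apply filterlim_Cmod; intros eps Heps.
assert (He2 : (0 < eps / 2)%R) by lra.
assert (HT : eventually
  (fun j => forall n, (Cmod (Csum (fun i => (v j i - u i)%C) n) < eps / 2)%R)).
{ apply (tannery_uniform (fun j i => (v j i - u i)%C) (2 * B) r); auto.
  - intros j i; unfold Cminus; eapply Rle_trans; [apply Cmod_triangle |].
    rewrite Cmod_opp; specialize (Hv j i); specialize (HuB i); lra.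
  - intros i; replace (RtoC 0) with (u i - u i) by ring.
    apply Clim_minus; [apply Hu | apply Clim_const]. }
revert HT; apply filter_imp; intros j Hj.
apply Rle_lt_trans with (eps / 2)%R; [| lra].
apply (is_lim_seq_le (fun n => Cmod (Csum (v j) n - Csum u n)) (fun _ => (eps / 2)%R)
         (Cmod (s j - t)) (eps / 2)%R).
- intros n; rewrite <- Csum_minus; left; apply Hj.
- apply Clim_norm, Clim_minus; [apply Hs | exact Ht].
- apply is_lim_seq_const.
Qed.

(** * Bounds and limits of q-Pochhammer symbols *)

Lemma qpoch_head (x q : C) (n : nat) :
  qpoch x q (S n) = (1 - x) * qpoch (x * q) q n.
Proof.
induction n as [|n IH]; [simpl; ring |].
change (qpoch x q (S n) * (1 - x * q ^ S n)
        = (1 - x) * (qpoch (x * q) q n * (1 - x * q * q ^ n))).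
rewrite IH, Cpow_S; ring.
Qed.

(** Each factor satisfies [|1 - x q^i| <= exp (|x| |q|^i)], and the exponents add up to a partial
    geometric sum, at most [|x| / (1 - |q|)]. *)
Lemma qpoch_bounded (x q : C) : (Cmod q < 1)%R ->
  exists B : R, (0 < B)%R /\ forall n, (Cmod (qpoch x q n) <= B)%R.
Proof.
intros Hq; pose proof (Cmod_ge_0 q) as Hq0; pose proof (Cmod_ge_0 x) as Hx0.
set (c := (Cmod x / (1 - Cmod q))%R).
assert (Hc : (0 <= c)%R) by (apply Rdiv_le_0_compat; lra).
exists (exp c); split; [apply exp_pos |]; intros n.
apply Rle_trans with (exp (c * (1 - Cmod q ^ n))).
- induction n as [|n IH].
  + simpl; rewrite Cmod_1; replace (c * (1 - 1))%R with 0%R by ring.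
    rewrite exp_0; lra.
  + simpl qpoch; rewrite Cmod_mult.
    replace (c * (1 - Cmod q ^ S n))%R
      with (c * (1 - Cmod q ^ n) + Cmod x * Cmod q ^ n)%R
      by (unfold c; simpl; field; lra).
    rewrite exp_plus; apply Rmult_le_compat; auto using Cmod_ge_0.
    eapply Rle_trans; [| apply exp_ineq1_le].
    unfold Cminus; eapply Rle_trans; [apply Cmod_triangle |].
    rewrite Cmod_1, Cmod_opp, Cmod_mult, Cmod_pow; lra.
- assert (0 <= Cmod q ^ n)%R by (apply pow_le; lra).
  destruct (Rle_lt_or_eq_dec _ _ (Rmult_le_compat_l c (1 - Cmod q ^ n) 1 Hc ltac:(lra)))
    as [H1 | H1].
  + left; apply exp_increasing; lra.
  + rewrite H1, Rmult_1_r; apply Rle_refl.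
Qed.

(** Consecutive products differ by [- (x;q)_i x q^i], which decays geometrically because the
    products are bounded; hence their telescoping series converges. *)
Lemma qpoch_inf_lim (x q : C) : (Cmod q < 1)%R -> Clim (qpoch x q) (qpoch_inf x q).
Proof.
intros Hq; destruct (qpoch_bounded x q Hq) as [B [_ HB]].
assert (Hex : exists l : C, Clim (qpoch x q) l).
{ destruct (Clim_Csum_geom (fun i => qpoch x q (S i) - qpoch x q i)
              (B * Cmod x) (Cmod q)) as [l Hl].
  - split; [apply Cmod_ge_0 | exact Hq].
  - intros i; simpl.
    replace (qpoch x q i * (1 - x * q ^ i) - qpoch x q i)
      with (- (qpoch x q i * (x * q ^ i))) by ring.
    rewrite Cmod_opp, !Cmod_mult, Cmod_pow, Rmult_assoc.
    apply Rmult_le_compat_r; [| apply HB].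
    apply Rmult_le_pos; [| apply pow_le]; apply Cmod_ge_0.
  - exists (l + 1); apply Clim_shift_inv.
    apply Clim_ext with (fun n => Csum (fun i => qpoch x q (S i) - qpoch x q i) n + 1).
    + intros n; rewrite (Csum_telescope _ (qpoch x q)) by reflexivity.
      change (qpoch x q 0) with (RtoC 1); ring.
    + apply Clim_plus; [exact Hl | apply Clim_const]. }
destruct Hex as [l Hl]; exact (Clim_iota _ l Hl).
Qed.

(** Weierstrass' inequality: a product of factors [1 - t_i] is at least 1 minus the sum of the
    [t_i]. Here [t_i = |x| |q|^i], with sum at most 1/2. *)
Lemma qpoch_bounded_below_small (x q : C) (n : nat) : (Cmod q < 1)%R ->
  (Cmod x <= (1 - Cmod q) / 2)%R -> (1 / 2 <= Cmod (qpoch x q n))%R.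
Proof.
intros Hq Hx; pose proof (Cmod_ge_0 q) as Hq0; pose proof (Cmod_ge_0 x) as Hx0.
set (c := (Cmod x / (1 - Cmod q))%R).
assert (Hc : (0 <= c)%R) by (apply Rdiv_le_0_compat; lra).
assert (Hc2 : (c <= 1 / 2)%R).
{ apply Rmult_le_reg_r with (1 - Cmod q)%R; [lra |].
  unfold c; field_simplify; lra. }
assert (Hp : forall m, (0 <= Cmod q ^ m <= 1)%R).
{ intros m; split; [apply pow_le; lra |].
  rewrite <- (pow1 m); apply pow_incr; lra. }
apply Rle_trans with (1 - c * (1 - Cmod q ^ n))%R.
- specialize (Hp n); nra.
- induction n as [|n IH]; [simpl; rewrite Cmod_1; lra |].
  simpl qpoch; rewrite Cmod_mult.
  assert (H1 : (1 - Cmod x * Cmod q ^ n <= Cmod (1 - x * q ^ n))%R).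
  { pose proof (Cmod_triangle (1 - x * q ^ n) (x * q ^ n)) as H.
    replace (1 - x * q ^ n + x * q ^ n) with (RtoC 1) in H by ring.
    rewrite Cmod_1, Cmod_mult, Cmod_pow in H; lra. }
  replace (1 - c * (1 - Cmod q ^ S n))%R
    with (1 - c * (1 - Cmod q ^ n) - Cmod x * Cmod q ^ n)%R
    by (unfold c; simpl; field; lra).
  specialize (Hp n).
  assert (0 <= Cmod x * Cmod q ^ n <= 1)%R by nra.
  assert (0 <= c * (1 - Cmod q ^ n) <= 1)%R by nra.
  apply Rle_trans with ((1 - c * (1 - Cmod q ^ n)) * (1 - Cmod x * Cmod q ^ n))%R.
  + nra.
  + apply Rmult_le_compat; lra.
Qed.

(** Splitting off the first factor replaces [x] by [x q]. After [N] such steps the base is small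
    enough for the previous bound, and the finitely many factors removed are nonzero. *)
Lemma qpoch_bounded_below (x q : C) : (Cmod q < 1)%R ->
  (forall n, qpoch x q n <> 0) ->
  exists c : R, (0 < c)%R /\ forall n, (c <= Cmod (qpoch x q n))%R.
Proof.
intros Hq Hx; pose proof (Cmod_ge_0 q) as Hq0.
assert (He : (0 < (1 - Cmod q) / 2)%R) by lra.
destruct (proj2 (is_lim_seq_spec _ _)
            (lim_geom (Cmod x) (Cmod q) (conj Hq0 Hq)) (mkposreal _ He)) as [N HN].
specialize (HN N (Nat.le_refl _)); simpl pos in HN.
rewrite Rminus_0_r in HN; apply Rabs_def2 in HN as [HN _].
revert x Hx HN; induction N as [|N IH]; intros x Hx HN.
- exists (1 / 2)%R; split; [lra |]; intros n.
  apply qpoch_bounded_below_small; auto; simpl in HN; lra.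
- assert (H1 : 1 - x <> 0).
  { specialize (Hx 1%nat); intros H; apply Hx; simpl.
    replace (1 * (1 - x * 1)) with (1 - x) by ring; exact H. }
  destruct (IH (x * q)) as [c [Hc Hn]].
  + intros n H; apply (Hx (S n)); rewrite qpoch_head, H; ring.
  + rewrite Cmod_mult; simpl in HN; lra.
  + pose proof (proj1 (Cmod_gt_0 _) H1) as H1'.
    (* The minimum with 1 accounts for the empty product. *)
    exists (Rmin 1 (Cmod (1 - x) * c)); split.
    * apply Rmin_pos; [lra | nra].
    * intros [|n]; [simpl; rewrite Cmod_1; apply Rmin_l |].
      eapply Rle_trans; [apply Rmin_r |].
      rewrite qpoch_head, Cmod_mult; apply Rmult_le_compat_l; [lra | apply Hn].
Qed.

Lemma qpoch_inf_neq_0 (x q : C) : (Cmod q < 1)%R ->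
  (forall n, qpoch x q n <> 0) -> qpoch_inf x q <> 0.
Proof.
intros Hq Hx; destruct (qpoch_bounded_below x q Hq Hx) as [c [Hc Hn]].
apply Cmod_gt_0; apply Rlt_le_trans with c; [exact Hc |].
apply (is_lim_seq_le (fun _ => c) (fun n => Cmod (qpoch x q n)) c
         (Cmod (qpoch_inf x q)) Hn).
- apply is_lim_seq_const.
- apply Clim_norm, qpoch_inf_lim, Hq.
Qed.

Lemma qpoch_factor_neq_0 (x q : C) :
  (forall n, qpoch x q n <> 0) -> forall n, 1 - x * q ^ n <> 0.
Proof. intros Hx n H; apply (Hx (S n)); simpl; rewrite H; ring. Qed.

Lemma pow_neq_1 (q : C) (n : nat) : (Cmod q < 1)%R -> 1 - q ^ S n <> 0.
Proof.
intros Hq H; apply (Rlt_irrefl 1).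
assert (E : q ^ S n = 1)
  by (replace (q ^ S n) with (1 - (1 - q ^ S n)) by ring; rewrite H; ring).
rewrite <- Cmod_1 at 1; rewrite <- E, Cmod_pow; simpl.
pose proof (Cmod_ge_0 q).
assert (0 <= Cmod q ^ n <= 1)%R.
{ split; [apply pow_le; lra |]; rewrite <- (pow1 n); apply pow_incr; lra. }
nra.
Qed.

Lemma qpoch_q_neq_0 (q : C) (n : nat) : (Cmod q < 1)%R -> qpoch q q n <> 0.
Proof.
intros Hq; induction n as [|n IH]; simpl; [exact C1_nz |].
apply Cmult_neq_0; [exact IH | apply (pow_neq_1 q n Hq)].
Qed.

(** * The q-binomial theorem *)

Definition qbinom_coef (a q : C) (n : nat) : C := qpoch a q n / qpoch q q n.

Lemma qbinom_coef_S (a q : C) (n : nat) : (Cmod q < 1)%R ->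
  (1 - q ^ S n) * qbinom_coef a q (S n) = (1 - a * q ^ n) * qbinom_coef a q n.
Proof.
intros Hq; pose proof (qpoch_q_neq_0 q n Hq); pose proof (pow_neq_1 q n Hq) as H1.
unfold qbinom_coef; simpl; simpl in H1; field; auto.
Qed.

Lemma qbinom_coef_bounded (a q : C) : (Cmod q < 1)%R ->
  exists B : R, (0 < B)%R /\ forall n, (Cmod (qbinom_coef a q n) <= B)%R.
Proof.
intros Hq; destruct (qpoch_bounded a q Hq) as [A [HA Ha]].
destruct (qpoch_bounded_below q q Hq (fun n => qpoch_q_neq_0 q n Hq)) as [c [Hc Hn]].
exists (A / c)%R; split; [apply Rdiv_lt_0_compat; lra |]; intros n.
unfold qbinom_coef; rewrite Cmod_div by (apply qpoch_q_neq_0, Hq).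
apply Rmult_le_compat; [apply Cmod_ge_0 | | apply Ha | apply Rinv_le_contravar; auto].
left; apply Rinv_0_lt_compat; apply Rlt_le_trans with c; auto.
Qed.

Lemma qbinom_coef_lim (a q : C) : (Cmod q < 1)%R ->
  Clim (qbinom_coef a q) (qpoch_inf a q / qpoch_inf q q).
Proof.
intros Hq; destruct (qpoch_bounded_below q q Hq (fun n => qpoch_q_neq_0 q n Hq))
  as [c [Hc Hn]].
apply (Clim_mult (qpoch a q) (fun n => / qpoch q q n)).
- apply qpoch_inf_lim, Hq.
- apply Clim_inv with c; auto using qpoch_inf_lim.
Qed.

(* The telescoping certificate is [H n = c_n x^n (1 - q^n)]. *)
Lemma q_binomial_shift (a q x f f' : C) : (Cmod q < 1)%R -> (Cmod x < 1)%R ->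
  Clim (Csum (fun n => qbinom_coef a q n * x ^ n)) f ->
  Clim (Csum (fun n => qbinom_coef a q n * (x * q) ^ n)) f' ->
  (1 - x) * f = (1 - a * x) * f'.
Proof.
intros Hq Hx Hf Hf'.
destruct (qbinom_coef_bounded a q Hq) as [B [HB Hb]].
set (H := fun n => qbinom_coef a q n * x ^ n * (1 - q ^ n)).
assert (HH : Clim H 0).
{ apply Clim_squeeze with (fun n => (B * 2 * Cmod x ^ n)%R).
  - intros n; unfold H.
    replace (qbinom_coef a q n * x ^ n * (1 - q ^ n) - 0)
      with (qbinom_coef a q n * (1 - q ^ n) * x ^ n) by ring.
    rewrite !Cmod_mult, Cmod_pow.
    apply Rmult_le_compat_r; [apply pow_le, Cmod_ge_0 |].
    apply Rmult_le_compat; auto using Cmod_ge_0.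
    unfold Cminus; eapply Rle_trans; [apply Cmod_triangle |].
    rewrite Cmod_1, Cmod_opp, Cmod_pow.
    assert (Cmod q ^ n <= 1)%R.
    { rewrite <- (pow1 n); apply pow_incr; split; [apply Cmod_ge_0 | lra]. }
    lra.
  - apply lim_geom; split; [apply Cmod_ge_0 | exact Hx]. }
assert (E : (1 - x) * f - (1 - a * x) * f' = 0).
{ apply Clim_unique with
    (fun n => (1 - x) * Csum (fun n => qbinom_coef a q n * x ^ n) n
              - (1 - a * x) * Csum (fun n => qbinom_coef a q n * (x * q) ^ n) n).
  - apply Clim_minus; apply Clim_scal; assumption.
  - apply Clim_ext with (fun n => (-1) * H (n + 1)%nat).
    + intros n; rewrite <- !Csum_scal, <- Csum_minus.
      (* The sum collapses to [- H (n + 1)], since [1 - q^0 = 0] makes [H 0] vanish. *)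
      rewrite (Csum_telescope _ (fun n => (-1) * H n)).
      * rewrite Nat.add_1_r; unfold H at 3; simpl; ring.
      * intros i; unfold H.
        replace (-1 * (qbinom_coef a q (S i) * x ^ S i * (1 - q ^ S i)))
          with (-1 * (((1 - q ^ S i) * qbinom_coef a q (S i)) * x ^ S i)) by ring.
        rewrite qbinom_coef_S, Cpow_mult_l, Cpow_S by assumption; ring.
    + replace (RtoC 0) with ((-1) * 0) by ring.
      apply Clim_scal, (Clim_shift H 0 1), HH. }
replace ((1 - x) * f) with ((1 - x) * f - (1 - a * x) * f' + (1 - a * x) * f') by ring.
rewrite E; ring.
Qed.

(** Iterating the functional equation gives [(x;q)_j f(x) = (a x;q)_j f(x q^j)], where [f(x q^j)]
    tends to [f(0) = 1]. *)
Lemma q_binomial (a q x f : C) : (Cmod q < 1)%R -> (Cmod x < 1)%R ->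
  Clim (Csum (fun n => qbinom_coef a q n * x ^ n)) f ->
  qpoch_inf x q * f = qpoch_inf (a * x) q.
Proof.
intros Hq Hx Hf.
pose proof (Cmod_ge_0 q) as Hq0; pose proof (Cmod_ge_0 x) as Hx0.
destruct (qbinom_coef_bounded a q Hq) as [B [HB Hb]].
assert (Hqj : forall j, (0 <= Cmod q ^ j <= 1)%R).
{ intros j; split; [apply pow_le; lra |]; rewrite <- (pow1 j); apply pow_incr; lra. }
assert (Hv : forall j i,
  (Cmod (qbinom_coef a q i * (x * q ^ j) ^ i) <= B * Cmod x ^ i)%R).
{ intros j i; rewrite Cmod_mult, Cmod_pow, Cmod_mult, Cmod_pow.
  apply Rmult_le_compat; auto using Cmod_ge_0.
  - apply pow_le; specialize (Hqj j); nra.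
  - apply pow_incr; specialize (Hqj j); nra. }
assert (Hs : exists s : nat -> C, forall j,
  Clim (Csum (fun n => qbinom_coef a q n * (x * q ^ j) ^ n)) (s j)).
{ exists (fun j => iota (T := C_CompleteNormedModule) (fun l : C =>
      Clim (Csum (fun n => qbinom_coef a q n * (x * q ^ j) ^ n)) l)).
  intros j; destruct (Clim_Csum_geom _ _ _ (conj Hx0 Hx) (Hv j)) as [l Hl].
  exact (Clim_iota _ l Hl). }
destruct Hs as [s Hs].
assert (Hs0 : s 0%nat = f).
{ apply Clim_unique with (2 := Hf).
  apply Clim_ext with (2 := Hs 0%nat); intros n; apply Csum_ext; intros i _.
  f_equal; f_equal; simpl; ring. }
assert (Hiter : forall j, qpoch x q j * f = qpoch (a * x) q j * s j).
{ induction j as [|j IH]; [simpl; rewrite Hs0; ring |]; simpl.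
  assert (E : (1 - x * q ^ j) * s j = (1 - a * (x * q ^ j)) * s (S j)).
  { apply (q_binomial_shift a q); auto.
    - rewrite Cmod_mult, Cmod_pow; specialize (Hqj j); nra.
    - apply Clim_ext with (2 := Hs (S j)); intros n; apply Csum_ext; intros i _.
      f_equal; f_equal; simpl; ring. }
  replace (qpoch x q j * (1 - x * q ^ j) * f)
    with ((qpoch x q j * f) * (1 - x * q ^ j)) by ring.
  rewrite IH.
  replace (qpoch (a * x) q j * s j * (1 - x * q ^ j))
    with (qpoch (a * x) q j * ((1 - x * q ^ j) * s j)) by ring.
  rewrite E; ring. }
(* As [x q^j] tends to 0, only the constant term 1 of the series survives; [B |x|^i] is a majorant
   for all [j]. *)
assert (Hlim : Clim s 1).
{ apply (tannery (fun j i => qbinom_coef a q i * (x * q ^ j) ^ i)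
           (fun i => match i with O => 1 | S _ => 0 end) s 1 B (Cmod x)); auto.
  - intros [|i].
    + apply Clim_ext with (fun _ => 1); [| apply Clim_const].
      intros j; unfold qbinom_coef; simpl; field; exact C1_nz.
    + apply Clim_squeeze with (fun j => (B * Cmod q ^ j)%R);
        [| apply lim_geom; lra].
      intros j.
      replace (qbinom_coef a q (S i) * (x * q ^ j) ^ S i - 0)
        with (qbinom_coef a q (S i) * (x * q ^ j) ^ S i) by ring.
      rewrite Cmod_mult, Cmod_pow, Cmod_mult, Cmod_pow.
      apply Rmult_le_compat; auto using Cmod_ge_0.
      * apply pow_le; specialize (Hqj j); nra.
      * simpl; specialize (Hqj j).
        assert (0 <= (Cmod x * Cmod q ^ j) ^ i <= 1)%R.
        { split; [apply pow_le; nra |]; rewrite <- (pow1 i); apply pow_incr; nra. }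
        assert (0 <= Cmod x * Cmod q ^ j <= Cmod q ^ j)%R by nra.
        nra.
  - apply Clim_ext with (fun _ => 1); [| apply Clim_const].
    induction n as [|n IH]; [now rewrite Csum_0 |].
    rewrite Csum_S, <- IH; ring. }
apply Clim_unique with (fun j => qpoch x q j * f).
- apply Clim_mult; [apply qpoch_inf_lim, Hq | apply Clim_const].
- apply Clim_ext with (fun j => qpoch (a * x) q j * s j); [intros j; auto |].
  replace (qpoch_inf (a * x) q) with (qpoch_inf (a * x) q * 1) by ring.
  apply Clim_mult; [apply qpoch_inf_lim, Hq | exact Hlim].
Qed.

(** * The q-Gauss sum *)

(** This is [t_k(n)] of the overview: [k] is the distance of the two summation indices and [n] the
    smaller one. *)
Definition gauss_term (a q : C) (k n : nat) : C :=
  qpoch (q / a) q k / qpoch a q k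
  * (qbinom_coef a q (n + k) * qbinom_coef a q n * (q / a ^ 2) ^ n).

(** The bound is uniform in [k], as both the limit [k -> oo] and the summation over diagonals
    require. *)
Lemma gauss_term_bounded (a q : C) : (Cmod q < 1)%R ->
  (forall n, qpoch a q n <> 0) ->
  exists B : R, (0 < B)%R /\
    forall k n, (Cmod (gauss_term a q k n) <= B * Cmod (q / a ^ 2) ^ n)%R.
Proof.
intros Hq Ha.
destruct (qpoch_bounded (q / a) q Hq) as [A [HA HA']].
destruct (qpoch_bounded_below a q Hq Ha) as [c [Hc Hc']].
destruct (qbinom_coef_bounded a q Hq) as [B [HB HB']].
assert (HAc : (0 < A / c)%R) by (apply Rdiv_lt_0_compat; lra).
exists (A / c * (B * B))%R; split; [apply Rmult_lt_0_compat; nra |]; intros k n.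
unfold gauss_term; rewrite !Cmod_mult, Cmod_pow, <- Rmult_assoc.
apply Rmult_le_compat_r; [apply pow_le, Cmod_ge_0 |].
apply Rmult_le_compat; [apply Cmod_ge_0 | | |].
- apply Rmult_le_pos; apply Cmod_ge_0.
- rewrite Cmod_div by apply Ha.
  apply Rmult_le_compat; [apply Cmod_ge_0 | | apply HA' | apply Rinv_le_contravar; auto].
  left; apply Rinv_0_lt_compat; apply Rlt_le_trans with c; auto.
- apply Rmult_le_compat; auto using Cmod_ge_0.
Qed.

(** Serves the case [|q / a^2| >= 1], where it keeps the terms of each diagonal away from 0. The
    constant may depend on [k]. *)
Lemma gauss_term_bounded_below (a q : C) (k : nat) : (Cmod q < 1)%R ->
  (forall n, qpoch a q n <> 0) -> (forall n, qpoch (q / a) q n <> 0) ->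
  exists c : R, (0 < c)%R /\
    forall n, (c * Cmod (q / a ^ 2) ^ n <= Cmod (gauss_term a q k n))%R.
Proof.
intros Hq Ha Hqa.
destruct (qpoch_bounded q q Hq) as [A [HA HA']].
destruct (qpoch_bounded_below a q Hq Ha) as [c [Hc Hc']].
assert (Hd : (0 < c / A)%R) by (apply Rdiv_lt_0_compat; lra).
assert (Hb : forall n, (c / A <= Cmod (qbinom_coef a q n))%R).
{ intros n; unfold qbinom_coef; rewrite Cmod_div by apply qpoch_q_neq_0, Hq.
  apply Rmult_le_compat; [lra | left; apply Rinv_0_lt_compat; lra | apply Hc' |].
  apply Rinv_le_contravar; [| apply HA'].
  apply Cmod_gt_0, qpoch_q_neq_0, Hq. }
assert (He : (0 < Cmod (qpoch (q / a) q k / qpoch a q k))%R).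
{ rewrite Cmod_div by apply Ha.
  apply Rdiv_lt_0_compat; apply Cmod_gt_0; auto. }
exists (Cmod (qpoch (q / a) q k / qpoch a q k) * (c / A * (c / A)))%R.
split; [apply Rmult_lt_0_compat; nra |]; intros n.
unfold gauss_term; rewrite !Cmod_mult, Cmod_pow, Rmult_assoc.
apply Rmult_le_compat_l; [lra |].
apply Rmult_le_compat_r; [apply pow_le, Cmod_ge_0 |].
apply Rmult_le_compat; auto; lra.
Qed.

(** The certificate [G] is a rational multiple of the term itself. Once the recurrences of the
    symbols are applied, a common factor drops out and a rational identity in [a], [q], [q^n] and
    [q^k] remains. *)
Lemma gauss_term_telescope (a q : C) (k n : nat) : (Cmod q < 1)%R ->
  a <> 0 -> (forall n, qpoch a q n <> 0) ->
  let G := fun n => - (a * q ^ k / (1 - a * q ^ k)) * ((1 - q ^ n) * gauss_term a q k n) in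
  gauss_term a q (S k) n - gauss_term a q k n = G (S n) - G n.
Proof.
intros Hq Ha0 Ha G; unfold G, gauss_term.
pose proof (qpoch_factor_neq_0 a q Ha k) as Hk.
pose proof (pow_neq_1 q n Hq) as Hn.
pose proof (pow_neq_1 q (n + k) Hq) as Hnk.
assert (E1 : forall i, qbinom_coef a q (S i)
                       = (1 - a * q ^ i) / (1 - q ^ S i) * qbinom_coef a q i).
{ intros i; pose proof (pow_neq_1 q i Hq) as Hi.
  transitivity ((1 - q ^ S i) * qbinom_coef a q (S i) / (1 - q ^ S i)).
  - field; exact Hi.
  - rewrite qbinom_coef_S by exact Hq; field; exact Hi. }
rewrite Nat.add_succ_r; simpl (S n + k)%nat; rewrite !E1; simpl qpoch.
revert Hn Hnk; rewrite !Cpow_S, Cpow_add_r; intros Hn Hnk.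
field; repeat split; auto.
Qed.

(** [G] vanishes at 0 and at infinity, so the sum [s] is the same for all [k]. As [k -> oo] the
    summands tend to [L] times those of the q-binomial series at [z = q / a^2], with
    [L = (q/a;q)_oo / (q;q)_oo]. Since [a z = q / a], that series is [(q/a;q)_oo / (z;q)_oo]. *)
Lemma q_gauss (a q : C) (k : nat) : (Cmod q < 1)%R -> a <> 0 ->
  (Cmod (q / a ^ 2) < 1)%R -> (forall n, qpoch a q n <> 0) ->
  qpoch_inf (q / a ^ 2) q <> 0 ->
  Clim (Csum (gauss_term a q k))
    (qpoch_inf (q / a) q * qpoch_inf (q / a) q
     / (qpoch_inf q q * qpoch_inf (q / a ^ 2) q)).
Proof.
intros Hq Ha0 Hz Ha Hz0.
set (z := q / a ^ 2) in *.
pose proof (Cmod_ge_0 z) as Hzp.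
destruct (gauss_term_bounded a q Hq Ha) as [B [HB Ht]]; fold z in Ht.
destruct (qbinom_coef_bounded a q Hq) as [B' [HB' Hb]].
destruct (Clim_Csum_geom (gauss_term a q 0) B (Cmod z)) as [s Hs]; auto.
assert (Hall : forall k, Clim (Csum (gauss_term a q k)) s).
{ clear k; induction k as [|k IH]; [exact Hs |].
  set (G := fun n => - (a * q ^ k / (1 - a * q ^ k)) * ((1 - q ^ n) * gauss_term a q k n)).
  assert (HG : Clim G 0).
  { replace (RtoC 0) with (- (a * q ^ k / (1 - a * q ^ k)) * 0) by ring.
    apply Clim_scal.
    apply Clim_squeeze with (fun n => (2 * B * Cmod z ^ n)%R).
    - intros n.
      replace ((1 - q ^ n) * gauss_term a q k n - 0)
        with ((1 - q ^ n) * gauss_term a q k n) by ring.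
      rewrite Cmod_mult, Rmult_assoc.
      apply Rmult_le_compat; auto using Cmod_ge_0.
      unfold Cminus; eapply Rle_trans; [apply Cmod_triangle |].
      rewrite Cmod_1, Cmod_opp, Cmod_pow.
      assert (Cmod q ^ n <= 1)%R.
      { rewrite <- (pow1 n); apply pow_incr; split; [apply Cmod_ge_0 | lra]. }
      lra.
    - apply lim_geom; split; assumption. }
  apply Clim_ext with (fun n => Csum (gauss_term a q k) n + G (n + 1)%nat).
  - intros n; rewrite Nat.add_1_r.
    assert (E : Csum (fun i => gauss_term a q (S k) i - gauss_term a q k i) n
                = G (S n) - G 0%nat).
    { apply Csum_telescope; intros i; apply gauss_term_telescope; assumption. }
    assert (HG0 : G 0%nat = 0) by (unfold G; simpl; ring).
    rewrite Csum_minus, HG0 in E.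
    replace (G (S n)) with (G (S n) - 0) by ring.
    rewrite <- E; ring.
  - replace s with (s + 0) by ring.
    apply Clim_plus; [exact IH | apply (Clim_shift G 0 1), HG]. }
destruct (Clim_Csum_geom (fun n => qbinom_coef a q n * z ^ n) B' (Cmod z))
  as [f Hf]; [auto | |].
{ intros i; rewrite Cmod_mult, Cmod_pow.
  apply Rmult_le_compat_r; [apply pow_le, Cmod_ge_0 | apply Hb]. }
pose proof (q_binomial a q z f Hq Hz Hf) as Hbin.
replace (a * z) with (q / a) in Hbin by (unfold z; field; exact Ha0).
pose proof (qpoch_inf_neq_0 q q Hq (fun n => qpoch_q_neq_0 q n Hq)) as Hqq.
pose proof (qpoch_inf_neq_0 a q Hq Ha) as Haa.
destruct (qpoch_bounded_below a q Hq Ha) as [c [Hc Hc']].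
set (L := qpoch_inf (q / a) q / qpoch_inf q q) in *.
assert (Hlim : Clim (fun _ : nat => s) (L * f)).
{ apply (tannery (gauss_term a q) (fun n => L * (qbinom_coef a q n * z ^ n))
           (fun _ => s) (L * f) B (Cmod z)); auto.
  - intros i; unfold gauss_term; fold z.
    (* The factor [(a;q)_oo] is inserted and cancelled: it is the limit both of the denominator
       [(a;q)_k] and of the numerator of the shifted coefficient. *)
    replace (L * (qbinom_coef a q i * z ^ i))
      with (qpoch_inf (q / a) q * / qpoch_inf a q
            * (qpoch_inf a q / qpoch_inf q q * (qbinom_coef a q i * z ^ i)))
      by (unfold L; field; auto).
    apply Clim_mult.
    + apply Clim_mult; [apply qpoch_inf_lim, Hq |].
      apply Clim_inv with c; auto using qpoch_inf_lim.
    + apply Clim_ext with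
        (fun k => qbinom_coef a q (k + i) * (qbinom_coef a q i * z ^ i)).
      * intros j; rewrite (Nat.add_comm j i); ring.
      * apply Clim_mult; [| apply Clim_const].
        apply Clim_shift, qbinom_coef_lim, Hq.
  - apply Clim_ext with (fun n => L * Csum (fun n => qbinom_coef a q n * z ^ n) n).
    + intros n; now rewrite Csum_scal.
    + apply Clim_scal, Hf. }
replace (qpoch_inf (q / a) q * qpoch_inf (q / a) q / (qpoch_inf q q * qpoch_inf z q))
  with s; [apply Hall |].
rewrite (Clim_unique _ _ _ (Clim_const s) Hlim), <- Hbin.
unfold L; rewrite <- Hbin; field; auto.
Qed.

(** * Coefficients of the double series on both sides of the diagonal *)

Lemma qpochZ_of_nat (x q : C) (k : nat) : qpochZ x q (Z.of_nat k) = qpoch x q k.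
Proof. destruct k as [|k]; [reflexivity |]; simpl; now rewrite SuccNat2Pos.id_succ. Qed.

Lemma qpochZ_opp_of_nat (x q : C) (k : nat) :
  qpochZ x q (- Z.of_nat k) = 1 / qpoch (x / q ^ k) q k.
Proof.
destruct k as [|k]; [simpl; field; exact C1_nz |].
unfold qpochZ; simpl Z.opp; cbv iota; now rewrite SuccNat2Pos.id_succ.
Qed.

(** From [1 - a q^(-j) = - a q^(-j) (1 - q^j / a)], reversal turns [(a q^(-n);q)_n] into a monomial
    times [(q/a;q)_n], and likewise with [q/a] for [a]. The two monomials differ by the factor
    [(q / a^2)^n]. *)
Lemma qpoch_reflect (a q : C) (n : nat) : q <> 0 -> a <> 0 ->
  qpoch (a / q ^ n) q n * qpoch a q n * (q / a ^ 2) ^ n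
  = qpoch (q / a / q ^ n) q n * qpoch (q / a) q n.
Proof.
intros Hq Ha; induction n as [|n IH]; [simpl; ring |].
pose proof (Cpow_nz q n Hq) as Hn.
rewrite !qpoch_head.
replace (a / q ^ S n * q) with (a / q ^ n) by (rewrite Cpow_S; field; auto).
replace (q / a / q ^ S n * q) with (q / a / q ^ n) by (rewrite Cpow_S; field; auto).
(* First factors are split off only for the two shifted bases; the symbols in [a] and [q / a] are
   folded back and lose their last factor instead. *)
rewrite <- !qpoch_head; simpl qpoch; rewrite (Cpow_S (q / a ^ 2)).
transitivity ((qpoch (a / q ^ n) q n * qpoch a q n * (q / a ^ 2) ^ n)
  * ((1 - a / q ^ S n) * (1 - a * q ^ n) * (q / a ^ 2))); [ring |].
rewrite IH, Cpow_S; field; auto.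
Qed.

Lemma double_term_above (a q : C) (k n : nat) : 
  (Cmod q < 1)%R -> (forall n, qpoch a q n <> 0) ->
  (qpoch a q (n + k) * qpoch a q n
     * qpochZ (q / a) q (Z.of_nat (n + k) - Z.of_nat n))
  / (qpoch q q (n + k) * qpoch q q n
     * qpochZ a q (Z.of_nat (n + k) - Z.of_nat n))
  * (q / a ^ 2) ^ n = gauss_term a q k n.
Proof.
intros Hq Ha.
replace (Z.of_nat (n + k) - Z.of_nat n)%Z with (Z.of_nat k) by lia.
rewrite !qpochZ_of_nat; unfold gauss_term, qbinom_coef.
pose proof (qpoch_q_neq_0 q n Hq); pose proof (qpoch_q_neq_0 q (n + k) Hq).
generalize ((q / a ^ 2) ^ n) (qpoch (q / a) q k); intros; field; auto.
Qed.

(** The symmetry in the two indices: reflection turns the quotient of symbols of index [-k],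
    together with the surplus power [(q / a^2)^k], into the quotient of index [k]. *)
Lemma double_term_below (a q : C) (k n : nat) :
  (Cmod q < 1)%R -> q <> 0 -> a <> 0 -> (forall n, qpoch a q n <> 0) ->
  (forall n, qpoch (a / q ^ n) q n <> 0) ->
  (forall n, qpoch (q / a / q ^ n) q n <> 0) ->
  (qpoch a q n * qpoch a q (n + k)
     * qpochZ (q / a) q (Z.of_nat n - Z.of_nat (n + k)))
  / (qpoch q q n * qpoch q q (n + k)
     * qpochZ a q (Z.of_nat n - Z.of_nat (n + k)))
  * (q / a ^ 2) ^ (n + k) = gauss_term a q k n.
Proof.
intros Hq Hq0 Ha0 Ha Han Hqan.
replace (Z.of_nat n - Z.of_nat (n + k))%Z with (- Z.of_nat k)%Z by lia.
rewrite !qpochZ_opp_of_nat; unfold gauss_term, qbinom_coef.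
pose proof (qpoch_q_neq_0 q n Hq); pose proof (qpoch_q_neq_0 q (n + k) Hq).
assert (E : qpoch (q / a) q k
  = qpoch (a / q ^ k) q k * qpoch a q k * (q / a ^ 2) ^ k / qpoch (q / a / q ^ k) q k).
{ rewrite qpoch_reflect by assumption; generalize (Hqan k).
  generalize (qpoch (q / a / q ^ k) q k) (qpoch (q / a) q k); intros; field; auto. }
rewrite E, Cpow_add_r; generalize (Hqan k) (Han k) (Ha k).
generalize (qpoch (q / a / q ^ k) q k) (qpoch (a / q ^ k) q k)
  ((q / a ^ 2) ^ k) ((q / a ^ 2) ^ n).
intros; field; auto.
Qed.

(** Reflection transfers nonvanishing to [(q/a;q)_n], which the lower bound on the terms
    requires. *)
Lemma qpoch_reflect_neq_0 (a q : C) (n : nat) : q <> 0 -> a <> 0 ->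
  qpoch a q n <> 0 -> qpoch (a / q ^ n) q n <> 0 -> qpoch (q / a) q n <> 0.
Proof.
intros Hq Ha H1 H2 H.
assert (E := qpoch_reflect a q n Hq Ha); rewrite H, Cmult_0_r in E.
revert E; apply Cmult_neq_0; [apply Cmult_neq_0; assumption |].
apply Cpow_nz; intros Hz; apply Hq.
replace q with (q / a ^ 2 * a ^ 2) by (field; exact Ha); rewrite Hz; ring.
Qed.

(** * Summation over squares and along diagonals *)

(** [D k n] collects the entries whose indices have distance [k] and minimum [n]; the square with
    largest index [N] contains exactly those with [n <= N - k]. *)
Lemma Csum_square (F D : nat -> nat -> C) (N : nat) :
  (forall n, D 0%nat n = F n n) ->
  (forall k n, D (S k) n = F (n + S k)%nat n + F n (n + S k)%nat) ->
  Csum (fun m => Csum (F m) N) N = Csum (fun k => Csum (D k) (N - k)) N.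
Proof.
intros D0 DS; induction N as [|N IH]; [now rewrite !Csum_0, D0 |].
transitivity (Csum (fun m => Csum (F m) N) N
  + (F (S N) (S N) + (Csum (F (S N)) N + Csum (fun m => F m (S N)) N))).
- rewrite Csum_S, Csum_S.
  rewrite (Csum_ext _ (fun m => Csum (F m) N + F m (S N)))
    by (intros; apply Csum_S).
  rewrite Csum_plus; ring.
- transitivity (Csum (fun k => Csum (D k) (N - k)) N
                + Csum (fun k => D k (S N - k)%nat) (S N)).
  (* The border added to the square is a corner, a row and a column; reversing the last two puts the
     entries with smaller index [N - k] at distance [S k]. *)
  + rewrite <- IH; f_equal; symmetry.
    rewrite Csum_head, Nat.sub_0_r, D0; f_equal.
    rewrite (Csum_ext _ (fun k => F (S N) (N - k)%nat + F (N - k)%nat (S N))).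
    * rewrite Csum_plus, (Csum_rev (F (S N))), (Csum_rev (fun m => F m (S N))).
      reflexivity.
    * intros k Hk; rewrite DS; simpl (S N - S k)%nat.
      now replace (N - k + S k)%nat with (S N) by lia.
  + rewrite !Csum_S, Nat.sub_diag, Csum_0, Cplus_assoc, <- Csum_plus; f_equal.
    apply Csum_ext; intros k Hk.
    rewrite Nat.sub_succ_l by exact Hk; symmetry; apply Csum_S.
Qed.

Lemma double_series_square (F : nat -> nat -> C) (l : C) :
  is_double_series F l -> Clim (fun N => Csum (fun m => Csum (F m) N) N) l.
Proof.
intros H; apply (filterlim_comp _ _ _ (fun N => (N, N)) _ _ _ _) with (2 := H).
apply filterlim_pair; apply filterlim_id.
Qed.

(** An entry is the mixed second difference of four neighbouring rectangular sums, each within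
    [eps / 4] of [l]. Two of these rectangles need not be squares even when [m = n], so independence
    of the two bounds matters. *)
Lemma double_series_terms (F : nat -> nat -> C) (l : C) :
  is_double_series F l -> forall eps : R, (0 < eps)%R ->
  exists N, forall m n, (N <= m)%nat -> (N <= n)%nat ->
  (Cmod (F (S m) (S n)) < eps)%R.
Proof.
intros H eps Heps; unfold is_double_series in H; rewrite filterlim_Cmod in H.
destruct (H (eps / 4)%R ltac:(lra)) as [Q1 Q2 [N1 H1] [N2 H2] HQ].
exists (max N1 N2); intros m n Hm Hn.
assert (HP : forall m n, (max N1 N2 <= m)%nat -> (max N1 N2 <= n)%nat ->
  (Cmod (Csum (fun m => Csum (F m) n) m - l) < eps / 4)%R).
{ intros i j Hi Hj; apply (HQ i j); [apply H1 | apply H2]; lia. }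
set (P := fun m n => Csum (fun m => Csum (F m) n) m) in *.
assert (E : F (S m) (S n)
  = ((P (S m) (S n) - l) + - (P m (S n) - l)) + (- (P (S m) n - l) + (P m n - l))).
{ unfold P; rewrite !Csum_S; ring. }
rewrite E; eapply Rle_lt_trans; [apply Cmod_triangle |].
pose proof (Cmod_triangle (P (S m) (S n) - l) (- (P m (S n) - l))) as T1.
pose proof (Cmod_triangle (- (P (S m) n - l)) (P m n - l)) as T2.
rewrite Cmod_opp in T1, T2.
pose proof (HP (S m) (S n) ltac:(lia) ltac:(lia)).
pose proof (HP m (S n) ltac:(lia) ltac:(lia)).
pose proof (HP (S m) n ltac:(lia) ltac:(lia)).
pose proof (HP m n ltac:(lia) ltac:(lia)).
fold (P (S m) (S n)) (P m (S n)) (P (S m) n) (P m n) in *.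
lra.
Qed.

Lemma Cmod_small_eq_0 (x : C) :
  (forall eps : R, (0 < eps)%R -> (Cmod x < eps)%R) -> x = 0.
Proof.
intros H; apply Cmod_eq_0; pose proof (Cmod_ge_0 x).
destruct (Req_dec (Cmod x) 0) as [E | E]; [exact E |].
specialize (H (Cmod x) ltac:(lra)); lra.
Qed.

(* Summing along diagonals: only [h k -> 0] is used on top of the convergence
   of [sum h], so conditional convergence is enough. *)
Lemma diagonal_sums_lim (t : nat -> nat -> C) (h : nat -> C) (K s : C) (B r : R) :
  (0 <= r < 1)%R ->
  (forall k n, (Cmod (t k n) <= B * r ^ n)%R) ->
  (forall k, Clim (Csum (t k)) K) -> Clim (Csum h) s ->
  Clim (fun N => Csum (fun k => Csum (fun n => t k n * h k) (N - k)) N) (K * s).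
Proof.
intros Hr Ht HK Hs.
assert (HB : (0 <= B)%R)
  by (generalize (Ht 0%nat 0%nat), (Cmod_ge_0 (t 0%nat 0%nat)); simpl; lra).
assert (Hh : Clim h 0).
{ apply Clim_shift_inv, Clim_ext with (fun n => Csum h (n + 1) - Csum h n).
  - intros n; rewrite Nat.add_1_r, Csum_S; ring.
  - replace (RtoC 0) with (s - s) by ring.
    apply Clim_minus; [apply (Clim_shift (Csum h) s 1) |]; exact Hs. }
destruct (Clim_bounded h 0 Hh) as [A [HA Hh']].
set (B' := (B / (1 - r))%R).
assert (HB' : (0 <= B')%R) by (apply Rdiv_le_0_compat; lra).
(* [v N j] is the error on the diagonal [k = N - j]: [h k] times the tail left after truncation at
   [j]. Indexing by [j] exposes the decay [r^j]; the value 0 for [j > N] avoids truncated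
   subtraction. *)
set (v := fun N j => if (j <=? N)%nat then h (N - j)%nat * (K - Csum (t (N - j)%nat) j)
                     else RtoC 0).
assert (Hv : forall N j, (Cmod (v N j) <= Cmod (h (N - j)%nat) * (B' * r ^ j))%R).
{ intros N j; unfold v; destruct (j <=? N)%nat.
  - rewrite Cmod_mult; apply Rmult_le_compat_l; [apply Cmod_ge_0 |].
    apply Csum_tail_le; auto.
  - rewrite Cmod_0; apply Rmult_le_pos; [apply Cmod_ge_0 |].
    apply Rmult_le_pos; [exact HB' | apply pow_le; lra]. }
assert (Hv0 : Clim (fun N => Csum (v N) N) 0).
{ apply filterlim_Cmod; intros eps Heps.
  assert (HT : eventually (fun N => forall n, (Cmod (Csum (v N) n) < eps)%R)).
  { apply (tannery_uniform v (A * B') r); auto.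
    - intros N j; eapply Rle_trans; [apply Hv |]; rewrite Rmult_assoc.
      apply Rmult_le_compat_r; auto.
      apply Rmult_le_pos; [exact HB' | apply pow_le; lra].
    - intros j; apply Clim_squeeze with
        (fun N => (Cmod (h (N - j)%nat) * (B' * r ^ j))%R).
      + intros N; replace (v N j - 0) with (v N j) by ring; apply Hv.
      + replace (Finite 0) with (Finite (0 * (B' * r ^ j))%R) by (f_equal; ring).
        apply is_lim_seq_mult'; [| apply is_lim_seq_const].
        rewrite <- Cmod_0; apply Clim_norm, (Clim_comp h 0 (fun N => (N - j)%nat)).
        * intros Q [M HM]; exists (M + j)%nat; intros n Hn; apply HM; lia.
        * exact Hh. }
  revert HT; apply filter_imp; intros N HN.
  replace (Csum (v N) N - 0) with (Csum (v N) N) by ring; apply HN. }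
replace (K * s) with (K * s - 0) by ring.
apply Clim_ext with (fun N => K * Csum h N - Csum (v N) N).
- intros N; rewrite <- (Csum_rev (v N)), <- Csum_scal, <- Csum_minus.
  apply Csum_ext; intros k Hk; unfold v.
  replace (N - k <=? N)%nat with true by (symmetry; apply Nat.leb_le; lia).
  replace (N - (N - k))%nat with k by lia.
  rewrite (Csum_ext (fun n => t k n * h k) (fun n => h k * t k n)) by (intros; ring).
  rewrite Csum_scal; ring.
- apply Clim_minus; [apply Clim_scal, Hs | exact Hv0].
Qed.

Theorem theorem4 (q a : C) (g : Z -> C) (S1 S2 : C)
  (hq : (Cmod q < 1)%R)
  (* no denominator vanishes *)
  (hq0 : q <> 0)
  (ha0 : a <> 0)
  (ha : forall n : nat, qpoch a q n <> 0)
  (ha_neg : forall n : nat, qpoch (a / q ^ n) q n <> 0)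
  (hqa_neg : forall n : nat, qpoch ((q / a) / q ^ n) q n <> 0)
  (hqa2 : qpoch_inf (q / a ^ 2) q <> 0)
  (* both series converge *)
  (hS1 : is_double_series
          (fun m n : nat =>
             (qpoch a q m * qpoch a q n
                * qpochZ (q / a) q (Z.of_nat m - Z.of_nat n))
             / (qpoch q q m * qpoch q q n
                * qpochZ a q (Z.of_nat m - Z.of_nat n))
             * (q / a ^ 2) ^ n
             * g (Z.of_nat m - Z.of_nat n)%Z)
          S1)
  (hS2 : is_bilateral_series g S2) :
  S1 = (qpoch_inf (q / a) q * qpoch_inf (q / a) q)
      / (qpoch_inf q q * qpoch_inf (q / a ^ 2) q) * S2.
Proof.
match type of hS1 with is_double_series ?f _ => set (F := f) in hS1 end.
assert (Fabove : forall k n, F (n + k)%nat n = gauss_term a q k n * g (Z.of_nat k)).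
{ intros k n; unfold F; rewrite double_term_above by assumption.
  do 2 f_equal; lia. }
assert (Fbelow : forall k n, F n (n + k)%nat = gauss_term a q k n * g (- Z.of_nat k)%Z).
{ intros k n; unfold F; rewrite double_term_below by assumption.
  do 2 f_equal; lia. }
pose proof (double_series_square F S1 hS1) as hP.
(* The diagonals of distance [k] carry the same coefficients, so [g k] and [g (-k)] are paired; the
   default 0 counts [g 0] only once. *)
set (h := fun k => g (Z.of_nat k) + match k with O => 0 | S _ => g (- Z.of_nat k)%Z end).
assert (hh : Clim (Csum h) S2).
{ destruct hS2 as [lp [ln [Hp [Hn ->]]]].
  apply Clim_ext with (fun N => Csum (fun k => g (Z.of_nat k)) N
    + Csum (fun k => match k with O => 0 | S _ => g (- Z.of_nat k)%Z end) N).
  - intros N; now rewrite <- Csum_plus.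
  (* The series over negative indices starts at [-1], hence the shift by one past the default
     term. *)
  - apply Clim_plus; [exact Hp |]; apply Clim_shift_inv.
    apply Clim_ext with (2 := Hn); intros N; rewrite Csum_head.
    symmetry; apply Cplus_0_l. }
assert (hP' : Clim (fun N => Csum (fun k => Csum (fun n => gauss_term a q k n * h k)
                                            (N - k)) N) S1).
{ apply Clim_ext with (2 := hP); intros N; apply Csum_square.
  - intros n; rewrite <- (Nat.add_0_r n) at 2; rewrite Fabove; unfold h; ring.
  - intros k n; rewrite Fabove, Fbelow; unfold h; ring. }
destruct (Rlt_le_dec (Cmod (q / a ^ 2)) 1) as [hz | hz].
- destruct (gauss_term_bounded a q hq ha) as [B [_ HB]].
  apply Clim_unique with (1 := hP').
  apply (diagonal_sums_lim _ h _ S2 B (Cmod (q / a ^ 2))); auto.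
  + split; [apply Cmod_ge_0 | exact hz].
  + intros k; apply q_gauss; assumption.
(* The terms do not decay along diagonals unless [g] vanishes identically. *)
- assert (hqa : forall n, qpoch (q / a) q n <> 0)
    by (intros n; apply qpoch_reflect_neq_0; auto).
  (* The disjunction admits either side of the diagonal, so that the claim covers both [g k] and
     [g (-k)]. *)
  assert (Hg : forall k x, (forall n, F (n + k)%nat n = gauss_term a q k n * x
                            \/ F n (n + k)%nat = gauss_term a q k n * x) -> x = 0).
  { intros k x Hx.
    destruct (gauss_term_bounded_below a q k hq ha hqa) as [c [Hc Hcn]].
    apply Cmod_small_eq_0; intros eps Heps.
    destruct (double_series_terms F S1 hS1 (c * eps)%R) as [N HN]; [nra |].
    (* Entries are controlled at successor indices, hence [S N]. As the coefficient has modulus at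
       least [c], the tolerance [c * eps] leaves [|x| < eps]. *)
    assert (Hsmall : (Cmod (gauss_term a q k (S N) * x) < c * eps)%R).
    { destruct (Hx (S N)) as [<- | <-];
        [apply (HN (N + k)%nat N) | apply (HN N (N + k)%nat)]; lia. }
    rewrite Cmod_mult in Hsmall; specialize (Hcn (S N)).
    assert (1 <= Cmod (q / a ^ 2) ^ S N)%R by (apply pow_R1_Rle; exact hz).
    pose proof (Cmod_ge_0 x); apply Rmult_lt_reg_l with c; [exact Hc |].
    apply Rle_lt_trans with (2 := Hsmall); apply Rmult_le_compat_r; [assumption | nra]. }
  assert (h0 : forall k, h k = 0).
  { intros k; unfold h; rewrite (Hg k (g (Z.of_nat k))) by auto.
    destruct k as [|k]; [ring |].
    rewrite (Hg (S k) (g (- Z.of_nat (S k))%Z)) by auto; ring. }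
  assert (E2 : S2 = 0).
  { apply Clim_unique with (1 := hh), Clim_ext with (2 := Clim_const 0); intros n.
    (* Zero is written as [0 * 0] so that [Csum_scal] can pull out a factor 0. *)
    rewrite (Csum_ext h (fun _ => 0 * 0)) by (intros; rewrite h0; ring).
    rewrite Csum_scal; ring. }
  assert (E1 : S1 = 0).
  { apply Clim_unique with (1 := hP'), Clim_ext with (2 := Clim_const 0); intros N.
    rewrite (Csum_ext _ (fun _ => 0 * 0)), Csum_scal; [ring |].
    intros k _; rewrite h0.
    rewrite (Csum_ext _ (fun _ => 0 * 0)), Csum_scal; [ring |].
    intros; ring. }
  rewrite E1, E2; ring.
Qed.
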